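(* Let $\Gamma = H \wr_X G$ be a finitely generated wreath product, where $H \neq 1$ and $X \neq \emptyset$, and let $\chi: \Gamma \to \mathbb{R}$ be a non-trivial character. Set $M = \bigoplus_{x \in X} H_x \subseteq \Gamma$. \begin{enumerate} \item If $\chi|_M = 0$, then $[\chi] \in \Sigma^1(\Gamma)$ if and only if $[\chi|_G] \in \Sigma^1(G)$ and $\chi|_{G_x} \neq 0$ for all $x \in X$. \item If $\chi|_M \neq 0$, then $[\chi] \in \Sigma^1(\Gamma)$ if and only if at least one of the following conditions holds: (a) there exist $x, y \in X$ with $x \neq y$, $\chi|_{H_x} \neq 0$ and $\chi|_{H_y} \neq 0$; (b) there exists $x \in X$ with $\chi|_{H_x} \neq 0$ and $[\chi|_{H_x}] \in \Sigma^1(H)$; (c) $\chi|_G \neq 0$. \end{enumerate}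
   Context: Wreath product: given groups $H$, $G$ and a (left) $G$-set $X$, $H \wr_X G$ is the semidirect product $M \rtimes G$, where $M = \bigoplus_{x \in X} H_x$ is the restricted direct product of copies $H_x$ of $H$ indexed by $X$, and $G$ acts by permuting the copies according to its action on $X$. The groups $M$, $H_x$, $G$ are regarded as subgroups of $H \wr_X G$, and $H_x$ is identified with $H$. $G_x$ denotes the stabilizer in $G$ of $x \in X$. If $H\wr_X G$ is finitely generated (with $H\ne 1$, $X\neq\emptyset$), then $G$ and $H$ are finitely generated. Characters: for a finitely generated group $V$, a character is a homomorphism $\chi: V \to \mathbb{R}$ to the additive group of reals. The character sphere $S(V)$ is the set of non-zero characters modulo $\chi_1 \sim \chi_2$ iff $\chi_2 = r\chi_1$ for some real $r>0$; $[\chi]$ is the class of $\chi$. Put $V_\chi = \{v \in V \mid \chi(v) \geq 0\}$. Invariant $\Sigma^1$: for a finite generating set $\mathcal{X}$ of $V$, $Cay(V;\mathcal{X})$ is the Cayley graph with vertex set $V$, where $v_1, v_2$ are joined by an edge iff $v_2 = v_1 x$ for some $x \in \mathcal{X}^{\pm 1}$. $Cay(V;\mathcal{X})_\chi$ is the full subgraph spanned by $V_\chi$. Then $\Sigma^1(V) = \{[\chi] \in S(V) \mid Cay(V;\mathcal{X})_\chi \text{ is connected}\}$; this does not depend on the choice of finite generating set $\mathcal{X}$. An assertion such as $[\chi|_G] \in \Sigma^1(G)$ includes that $\chi|_G \neq 0$. *)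

(* Defs.v *)
From HB Require Import structures.
From Stdlib Require Import Relation_Operators.
From mathcomp Require Import all_boot all_order all_algebra.
From mathcomp Require Import boolp classical_sets functions cardinality reals.

Set Implicit Arguments.
Unset Strict Implicit.
Unset Printing Implicit Defensive.

Import Order.TTheory GRing.Theory Num.Theory.
Local Open Scope classical_set_scope.
Local Open Scope group_scope.

(* MathComp's library of actions only covers right actions of finite groups;
   here groups are arbitrary and act on the left. *)
Record gset_action (G : groupType) (X : Type) := GSetAction {
  gact :> G -> X -> X;
  gact1 : forall x, gact 1 x = x;
  gactM : forall g h x, gact (g * h) x = gact g (gact h x) }.

Definition stabilizer (G : groupType) (X : Type) (a : gset_action G X) (x : X) :
  set G := [set g | a g x = x].

Record aut_action (G M : groupType) := AutAction {
  aact :> gset_action G M;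
  aactM : forall g, {morph aact g : m n / m * n} }.

Record sdprod (G M : groupType) (a : aut_action G M) := SDProd {
  sdbase : M;
  sdtop : G }.
Arguments SDProd {G M} a _ _.

Section SemidirectProduct.
Context (G M : groupType) (a : aut_action G M).
Implicit Types u v w : sdprod a.

HB.instance Definition _ := gen_eqMixin (sdprod a).
HB.instance Definition _ := gen_choiceMixin (sdprod a).

Definition sd_one := SDProd a 1 1.
Definition sd_mul u v :=
  SDProd a (sdbase u * a (sdtop u) (sdbase v)) (sdtop u * sdtop v).
Definition sd_inv u := SDProd a (a (sdtop u)^-1 (sdbase u)^-1) (sdtop u)^-1.

Lemma aact1 g : a g 1 = 1.
Proof. by apply: (@mulgI _ (a g 1)); rewrite -aactM !mulg1. Qed.

Fact sd_mulA : associative sd_mul.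
Proof. by case=> [m g] [n h] [p k]; rewrite /sd_mul /= aactM gactM !mulgA. Qed.
Fact sd_mul1 : left_id sd_one sd_mul.
Proof. by case=> m g; rewrite /sd_mul /= gact1 !mul1g. Qed.
Fact sd_mulr1 : right_id sd_one sd_mul.
Proof. by case=> m g; rewrite /sd_mul /= aact1 !mulg1. Qed.
Fact sd_mulV : left_inverse sd_one sd_inv sd_mul.
Proof. by case=> m g; rewrite /sd_mul /= -aactM !mulVg aact1. Qed.
Fact sd_mulrV : right_inverse sd_one sd_inv sd_mul.
Proof. by case=> m g; rewrite /sd_mul /= -gactM !mulgV gact1 mulgV. Qed.

HB.instance Definition _ :=
  isGroup.Build (sdprod a) sd_mulA sd_mul1 sd_mulr1 sd_mulV sd_mulrV.

End SemidirectProduct.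

Record dirsum (H : groupType) (X : choiceType) := DirSum {
  dsval :> X -> H;
  dsfin : finite_set [set x | dsval x <> 1] }.

Section DirectSum.
Context (H : groupType) (X : choiceType).
Implicit Types m n p : dirsum H X.

HB.instance Definition _ := gen_eqMixin (dirsum H X).
HB.instance Definition _ := gen_choiceMixin (dirsum H X).

Lemma dirsumP m n : (forall x, m x = n x) -> m = n.
Proof.
case: m n => [f ff] [g gf] /= /funext fg; subst g.
by congr DirSum; apply: Prop_irrelevance.
Qed.

Fact ds_one_fin : finite_set [set x : X | (1 : H) <> 1].
Proof. by apply: (@sub_finite_set _ _ set0) => // x /= /(_ erefl). Qed.
Definition ds_one := DirSum ds_one_fin.

Fact ds_mul_fin m n : finite_set [set x | m x * n x <> 1].
Proof.
apply: (@sub_finite_set _ _ ([set x | m x <> 1] `|` [set x | n x <> 1])).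
  move=> x /= mn1; apply: contrapT => /not_orP[/contrapT mx /contrapT nx].
  by apply: mn1; rewrite mx nx mulg1.
by rewrite finite_setU; split; apply: dsfin.
Qed.
Definition ds_mul m n := DirSum (ds_mul_fin m n).

Fact ds_inv_fin m : finite_set [set x | (m x)^-1 <> 1].
Proof.
apply: (@sub_finite_set _ _ [set x | m x <> 1]); last exact: dsfin.
by move=> x /= mV1 mx; apply: mV1; rewrite mx invg1.
Qed.
Definition ds_inv m := DirSum (ds_inv_fin m).

Fact ds_mulA : associative ds_mul.
Proof. by move=> m n p; apply: dirsumP => x /=; rewrite mulgA. Qed.
Fact ds_mul1 : left_id ds_one ds_mul.
Proof. by move=> m; apply: dirsumP => x /=; rewrite mul1g. Qed.
Fact ds_mulr1 : right_id ds_one ds_mul.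
Proof. by move=> m; apply: dirsumP => x /=; rewrite mulg1. Qed.
Fact ds_mulV : left_inverse ds_one ds_inv ds_mul.
Proof. by move=> m; apply: dirsumP => x /=; rewrite mulVg. Qed.
Fact ds_mulrV : right_inverse ds_one ds_inv ds_mul.
Proof. by move=> m; apply: dirsumP => x /=; rewrite mulgV. Qed.

HB.instance Definition _ :=
  isGroup.Build (dirsum H X) ds_mulA ds_mul1 ds_mulr1 ds_mulV ds_mulrV.

Fact ds_single_fin (x : X) (h : H) :
  finite_set [set y | (if y == x then h else 1) <> 1].
Proof.
apply: (@sub_finite_set _ _ [set x]); last exact: finite_set1.
by move=> y /=; case: eqP.
Qed.
Definition ds_single x h : dirsum H X := DirSum (ds_single_fin x h).

Context (G : groupType) (a : gset_action G X).

Fact ds_perm_fin g m : finite_set [set x | m (a g^-1 x) <> 1].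
Proof.
apply: (@sub_finite_set _ _ (a g @` [set x | m x <> 1])).
  by move=> x /= mx; exists (a g^-1 x) => //; rewrite -gactM mulgV gact1.
exact/finite_image/dsfin.
Qed.

(* g moves the x-th coordinate to position g x, whence the inverse. *)
Definition ds_perm g m := DirSum (ds_perm_fin g m).

Fact ds_perm1 m : ds_perm 1 m = m.
Proof. by apply: dirsumP => x /=; rewrite invg1 gact1. Qed.
Fact ds_permM g h m : ds_perm (g * h) m = ds_perm g (ds_perm h m).
Proof. by apply: dirsumP => x /=; rewrite invgM gactM. Qed.
Fact ds_perm_morph g : {morph ds_perm g : m n / m * n}.
Proof. by move=> m n; apply: dirsumP. Qed.

Definition permute_copies : aut_action G (dirsum H X) :=
  @AutAction _ _ (GSetAction ds_perm1 ds_permM) ds_perm_morph.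

Definition wreath : groupType := sdprod permute_copies.

Definition in_base (m : dirsum H X) : wreath := SDProd permute_copies m 1.
Definition in_copy (x : X) (h : H) : wreath := in_base (ds_single x h).
Definition in_top (g : G) : wreath := SDProd permute_copies 1 g.

Lemma in_copyJ g x h : in_top g * in_copy x h * (in_top g)^-1 = in_copy (a g x) h.
Proof.
congr SDProd; last by rewrite /= mulg1 mulgV.
rewrite /= mul1g mulg1 invg1; apply: dirsumP => y /=; rewrite mulg1.
have -> // : (a g^-1 y == x) = (y == a g x).
by apply/eqP/eqP => [<-|->]; rewrite -gactM ?mulgV ?mulVg gact1.
Qed.

End DirectSum.
Arguments wreath H {X G} a.
Arguments in_base {H X G} a m.
Arguments in_copy {H X G} a x h.
Arguments in_top {H X G} a g.

Section BieriNeumannStrebel.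
Context (R : realType) (V : groupType).
Implicit Types (S T : set V) (chi : V -> R) (u v w : V).

Definition generated_subgroup S : set V :=
  smallest [set K : set V | group_closed (mem K)] S.

Definition fin_gen_set S := finite_set S /\ generated_subgroup S = setT.

Definition fin_gen := exists S, fin_gen_set S.

Definition is_character chi := {morph chi : u v / u * v >-> (u + v)%R}.

Definition zero_char : V -> R := cst 0%R.

(* The class of chi modulo positive scalars; the zero character is not
   excluded, but it is alone in its class. *)
Definition char_class chi : set (V -> R) :=
  [set psi | exists2 r : R, (0 < r)%R & psi = (fun v => r * chi v)%R].

Definition char_sphere : set (set (V -> R)) :=
  [set char_class chi | chi in [set chi | is_character chi /\ chi <> zero_char]].

Definition cayley_edge S u v := exists2 x, S x \/ S x^-1 & v = u * x.

(* Connectedness of the full subgraph spanned by A. *)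
Definition cayley_connected S (A : set V) := forall u v, A u -> A v ->
  clos_refl_trans V (fun u v => [/\ A u, A v & cayley_edge S u v]) u v.

Definition nonneg_part chi : set V := [set v | (0 <= chi v)%R].

(* The choice of S is immaterial: see Sigma1P. *)
Definition Sigma1 : set (set (V -> R)) :=
  [set c | char_sphere c /\ exists2 chi, c = char_class chi &
     exists2 S, fin_gen_set S & cayley_connected S (nonneg_part chi)].

Section Independence.
Context (chi : V -> R) (chiM : is_character chi).

Let chi1 : chi 1 = 0%R.
Proof. by apply: (@addrI _ (chi 1)); rewrite -chiM mulg1 addr0. Qed.

Let chiV u : chi u^-1 = (- chi u)%R.
Proof. by apply/eqP; rewrite -addr_eq0 -chiM mulVg chi1. Qed.

Let chiX u n : chi (u ^+ n) = (chi u *+ n)%R.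
Proof. by elim: n => [|n IHn]; rewrite ?expg0 ?mulr0n// expgS chiM IHn mulrS. Qed.

Let walk T (c : R) := clos_refl_trans V (fun u v =>
  [/\ (c <= chi u)%R, (c <= chi v)%R & cayley_edge T u v]).

Let walk_sym T c u v : walk T c u v -> walk T c v u.
Proof.
elim=> [x y [cx cy [s sT yE]]|x|x y z _ IH1 _ IH2].
- apply: rt_step; split=> //; exists s^-1; last by rewrite yE mulgK.
  by rewrite invgK; case: sT; [right|left].
- exact: rt_refl.
- exact: rt_trans IH2 IH1.
Qed.

Let walkS T c d u v : (d <= c)%R -> walk T c u v -> walk T d u v.
Proof.
move=> dc; elim=> [x y [cx cy xy]|x|x y z _ IH1 _ IH2].
- by apply: rt_step; split=> //; apply: le_trans dc _.
- exact: rt_refl.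
- exact: rt_trans IH1 IH2.
Qed.

Let walkM T c g u v : walk T c u v -> walk T (chi g + c) (g * u) (g * v).
Proof.
elim=> [x y [cx cy [s sT yE]]|x|x y z _ IH1 _ IH2].
- apply: rt_step; split; rewrite ?chiM ?lerD2l//.
  by exists s => //; rewrite yE mulgA.
- exact: rt_refl.
- exact: rt_trans IH1 IH2.
Qed.

Let walk_bounded T : generated_subgroup T = setT ->
  forall v, exists c, walk T c 1 v.
Proof.
move=> Tgen v; have: generated_subgroup T v by rewrite Tgen.
apply: (@smallest_sub _ _ _ [set v | exists c, walk T c 1 v]) => /=; last first.
  move=> t Tt; exists (Num.min 0%R (chi t)); apply: rt_step; split.
  - by rewrite chi1 ge_min lexx.
  - by rewrite ge_min lexx orbT.
  - by exists t; [left|rewrite mul1g].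
split=> [|x y]; first by apply/mem_set; exists 0%R; apply: rt_refl.
move=> /set_mem[c cx] /set_mem[d dy]; apply/mem_set.
have /walk_sym := walkM (x / y) dy; rewrite mulg1 mulgVK.
move: (_ + d)%R => e ey; exists (Num.min c e); apply: (@rt_trans _ _ _ x).
  by apply: walkS cx; rewrite ge_min lexx.
by apply: walkS ey; rewrite ge_min lexx orbT.
Qed.

Lemma cayley_connected_indep S T :
    chi <> zero_char -> finite_set S -> generated_subgroup T = setT ->
  cayley_connected S (nonneg_part chi) -> cayley_connected T (nonneg_part chi).
Proof.
move=> chi_neq0 /finite_seqP[s ->] Tgen Sconn.
suff walk1 v : (0 <= chi v)%R -> walk T 0 1 v.
  by move=> u v Au Av; apply: rt_trans (walk1 _ Av); apply/walk_sym/walk1.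
have [C CP] : exists C : R, forall x, x \in s -> walk T C 1 x.
  elim: s {Sconn} => [|x s [C CP]]; first by exists 0%R.
  have [c cx] := walk_bounded Tgen x; exists (Num.min c C) => y.
  rewrite inE => /predU1P[->|/CP ys].
    by apply: walkS cx; rewrite ge_min lexx.
  by apply: walkS ys; rewrite ge_min lexx orbT.
have [t [tT t_gt0]] : exists t, (T t \/ T t^-1) /\ (0 < chi t)%R.
  apply: contrapT => tN; apply: chi_neq0; apply/funext => u.
  suff: generated_subgroup T `<=` [set w | chi w = 0%R] by apply; rewrite Tgen.
  apply: smallest_sub => /= [|t Tt].
    split=> [|x y]; first exact/mem_set.
    move=> /set_mem/= x0 /set_mem/= y0; apply/mem_set => /=.
    by rewrite chiM chiV x0 y0 subr0.
  apply: contrapT => /eqP; rewrite neq_lt => /orP[tlt0|tgt0]; apply: tN.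
    by exists t^-1; rewrite chiV oppr_gt0 invgK; split=> //; right.
  by exists t; split=> //; left.
have tpow w n : (0 <= chi w)%R -> walk T 0 w (w * t ^+ n).
  move=> w0; elim: n => [|n IHn]; first by rewrite expg0 mulg1; apply: rt_refl.
  apply: rt_trans IHn _; apply: rt_step; split.
  - by rewrite chiM chiX addr_ge0// mulrn_wge0// ltW.
  - by rewrite chiM chiX addr_ge0// mulrn_wge0// ltW.
  - by exists t => //; rewrite expgSr mulgA.
have [n nC] : exists n, (0 <= chi (t ^+ n) + C)%R.
  exists (Num.truncn (- C / chi t)).+1; rewrite chiX -lerBlDr sub0r -mulr_natl.
  by rewrite -ler_pdivrMr// ltW// truncnS_gt.
have shift u w : clos_refl_trans V (fun u v =>
      [/\ nonneg_part chi u, nonneg_part chi v & cayley_edge [set` s] u v]) u w ->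
    walk T 0 (t ^+ n * u) (t ^+ n * w).
  have pos z : (0 <= chi z)%R -> (0 <= chi (t ^+ n * z) + C)%R.
    by move=> z0; rewrite chiM addrAC addr_ge0.
  elim=> [x y [/= x0 y0 [r rs yE]]|x|x y z _ IH1 _ IH2].
  - case: rs => /CP/walkM rs.
      by have := rs (t ^+ n * x); rewrite mulg1 yE -mulgA; apply/walkS/pos.
    have := rs (t ^+ n * y); rewrite mulg1 -mulgA {3}yE mulgK.
    by move=> /walk_sym; apply/walkS/pos.
  - exact: rt_refl.
  - exact: rt_trans IH1 IH2.
move=> v0; apply: (@rt_trans _ _ _ (t ^+ n)).
  by have := tpow 1 n; rewrite mul1g chi1; apply.
apply: (@rt_trans _ _ _ (v * t ^+ n)); last exact/walk_sym/tpow.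
have := shift 1 (t ^- n * (v * t ^+ n)); rewrite mulg1 mulVKg; apply.
apply: Sconn; rewrite /nonneg_part /= ?chi1//.
by rewrite !chiM chiV addrC addrK.
Qed.

Lemma char_class_eqE psi : char_class chi = char_class psi ->
  exists2 r : R, (0 < r)%R & psi = (fun v => r * chi v)%R.
Proof.
move=> E; have : char_class psi psi.
  by exists 1%R => //; apply/funext => v; rewrite mul1r.
by rewrite -E.
Qed.

Lemma Sigma1P S : fin_gen_set S ->
  Sigma1 (char_class chi) <->
  chi <> zero_char /\ cayley_connected S (nonneg_part chi).
Proof.
move=> [Sfin Sgen]; split=> [|[chi0 conn]]; last first.
  by split; [exists chi|exists chi => //; exists S].
case=> -[psi [_ psi0] /esym/char_class_eqE[r r0 psiE]].
case=> phi /char_class_eqE[q q0 phiE] [T [Tfin Tgen]].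
have -> : nonneg_part phi = nonneg_part chi.
  by apply/seteqP; split=> v; rewrite /nonneg_part phiE /= pmulr_rge0.
have chi0 : chi <> zero_char.
  by move=> chi0; apply: psi0; rewrite psiE chi0; apply/funext => v; rewrite mulr0.
by move=> conn; split=> //; apply: cayley_connected_indep conn.
Qed.

End Independence.
End BieriNeumannStrebel.
Arguments zero_char {R V}.
Arguments Sigma1 R V : clear implicits.
Arguments fin_gen V : clear implicits.

(* Main.v *)
Require Import Defs.
From Stdlib Require Import Relation_Operators.
From mathcomp Require Import all_boot all_order all_algebra.
From mathcomp Require Import boolp classical_sets functions cardinality reals.

Set Implicit Arguments.
Unset Strict Implicit.
Unset Printing Implicit Defensive.

Import Order.TTheory GRing.Theory Num.Theory.

(** Write Gamma for the wreath product and M for its base group.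

Positive results.  Fix t with chi t > 0.  An element s is called liftable when,
for every level c and all large n, the vertices t^n and s t^n are joined by a
walk that stays at levels at least c and uses a fixed finite set of steps.
Liftable elements form a subgroup.  If they exhaust a finitely generated group,
then [chi] is in Sigma^1: given v with chi v >= 0, climb from 1 to t^n, cross to
v t^n, and descend to v (Sigma1_liftable).  Hence it suffices to lift the
elements of G and of the copies H_x.  There are two ways to do so.

- Commutation (liftable_commuting): s is liftable as soon as p s = s q for some
  p of positive character with p and q commuting with t.  If chi is non-zero on
  H_x and H_y, take t in H_x: an element of H_x commutes with an element of H_y,
  an element of another copy commutes with t, and g in G satisfies
  (g t g^-1) g = g t, where g t g^-1 lies in H_(g x) and hence commutes with t or
  is equal to it.  If chi is non-zero on G and, among the copies, on H_x only,
  then G fixes x, so it centralises H_x; elements of H_x are lifted by an element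
  of G, all others by t in H_x.

- A subgroup U containing t whose restricted character is in Sigma^1(U):
  elements of U are liftable, and so is every s that commutes with some element
  of U of positive character (liftable_subgroup, liftable_centralizing).  If chi
  vanishes on M, take U = G; elements of H_x commute with G_x, on which chi is
  non-zero.  If H_x is the only copy on which chi is non-zero, take U = H_x,
  which is centralised by G and by the other copies.

Negative results.  Sigma^1 passes to any quotient through which chi factors
(Sigma1_quotient).  If chi vanishes on M this quotient is G.  If chi vanishes on
G and on all copies but H_x, then G fixes x and the quotient is H, by evaluation
at x.  Finally, suppose that chi vanishes on M and on the stabiliser of x.  Then
g x |-> chi g is a well-defined height on the orbit of x.  Generate Gamma by G,
H_x and the copies outside this orbit; a walk above level 0 can then only change
coordinates of the orbit of non-negative height, so it never reaches a
non-trivial element of a copy of negative height, although chi is zero there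
(Sigma1_stabilizer). *)

(** * Generating sets and characters *)

Section GeneratingSets.
Local Open Scope classical_set_scope.
Local Open Scope group_scope.
Context (V : groupType).
Implicit Types (B S : set V).

Lemma generated_ind B (P : V -> Prop) :
    generated_subgroup B = setT -> P 1 ->
    (forall u v, P u -> P v -> P (u * v^-1)) -> (forall b, B b -> P b) ->
  forall v, P v.
Proof.
move=> Bgen P1 PV PB v; have: generated_subgroup B v by rewrite Bgen.
apply: (@smallest_sub _ _ _ [set v | P v]) => //; split=> [|x y].
  exact/mem_set.
by move=> /set_mem Px /set_mem Py; apply/mem_set/PV.
Qed.

(** Being generated by B means that B admits induction, so a new generating set
is recognised by deriving its induction principle from a known one. *)
Lemma generated_setT B :
    (forall P : V -> Prop, P 1 -> (forall u v, P u -> P v -> P (u * v^-1)) ->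
      (forall b, B b -> P b) -> forall v, P v) ->
  generated_subgroup B = setT.
Proof.
move=> Bind; apply/seteqP; split=> // v _ K [[K1 KV] BK].
apply: (Bind K) => [|u w Ku Kw|//]; first exact: set_mem.
by apply/set_mem/KV; apply/mem_set.
Qed.

End GeneratingSets.

Section Characters.
Local Open Scope group_scope.
Context (R : realType) (V : groupType) (chi : V -> R).
Hypothesis chiM : is_character chi.

Lemma char1 : chi 1 = 0%R.
Proof. by apply: (@addrI _ (chi 1)); rewrite -chiM mulg1 addr0. Qed.

Lemma charV u : chi u^-1 = (- chi u)%R.
Proof. by apply/eqP; rewrite -addr_eq0 -chiM mulVg char1. Qed.

Lemma charX u n : chi (u ^+ n) = (chi u *+ n)%R.
Proof.
by elim: n => [|n IHn]; rewrite ?expg0 ?mulr0n ?char1// expgS chiM IHn mulrS.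
Qed.

Lemma charV_gt0 u : chi u <> 0%R -> (0 < chi u)%R \/ (0 < chi u^-1)%R.
Proof. by move=> /eqP; rewrite neq_lt charV oppr_gt0 => /orP[]; [right|left]. Qed.

Lemma char_pos : chi <> zero_char -> exists t, (0 < chi t)%R.
Proof.
move=> chi0; apply: contrapT => tN; apply: chi0; apply/funext => u.
apply: contrapT => /charV_gt0[u0|u0]; apply: tN; first by exists u.
by exists u^-1.
Qed.

Lemma char_large t : (0 < chi t)%R ->
  forall c : R, exists N, forall n, (N <= n)%N -> (c <= chi (t ^+ n))%R.
Proof.
move=> t0 c; exists (Num.truncn (c / chi t)).+1 => n Nn; rewrite charX.
rewrite -mulr_natl -ler_pdivrMr//; apply: le_trans (ltW (truncnS_gt _)) _.
by rewrite ler_nat.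
Qed.

End Characters.

(** * Walks in the Cayley graph above a given level *)

Section Walks.
Local Open Scope classical_set_scope.
Local Open Scope group_scope.
Context (R : realType).

Definition walk (V : groupType) (chi : V -> R) (S : set V) (c : R) :=
  clos_refl_trans V (fun u v =>
    [/\ (c <= chi u)%R, (c <= chi v)%R & cayley_edge S u v]).

(** Translations, weakenings, projections to a quotient and inclusions of a
subgroup all respect edges and control how levels change. *)
Lemma walk_image (V W : groupType) (chi : V -> R) (psi : W -> R)
    (S : set V) (T : set W) (c d : R) (f : V -> W) :
    (forall u, (c <= chi u)%R -> (d <= psi (f u))%R) ->
    (forall u v, cayley_edge S u v -> cayley_edge T (f u) (f v)) ->
  forall u v, walk chi S c u v -> walk psi T d (f u) (f v).
Proof.
move=> fle fE u v; elim=> [x y [cx cy xy]|x|x y z _ IH1 _ IH2].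
- by apply: rt_step; split; [exact: fle|exact: fle|exact: fE].
- exact: rt_refl.
- exact: rt_trans IH1 IH2.
Qed.

Section OneGroup.
Context (V : groupType) (chi : V -> R).
Hypothesis chiM : is_character chi.
Implicit Types (S T : set V) (u v w t : V) (c d : R).

Lemma walk_sym S c u v : walk chi S c u v -> walk chi S c v u.
Proof.
elim=> [x y [cx cy [s sT yE]]|x|x y z _ IH1 _ IH2].
- apply: rt_step; split=> //; exists s^-1; last by rewrite yE mulgK.
  by rewrite invgK; case: sT; [right|left].
- exact: rt_refl.
- exact: rt_trans IH2 IH1.
Qed.

Lemma walkS S T c d u v : S `<=` T -> (d <= c)%R ->
  walk chi S c u v -> walk chi T d u v.
Proof.
move=> ST dc; apply: (walk_image (f := id)) => [x|x y [s sS ->]].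
  exact: le_trans.
by exists s => //; case: sS => /ST; [left|right].
Qed.

Lemma walkM S c g u v : walk chi S (c - chi g)%R u v ->
  walk chi S c (g * u) (g * v).
Proof.
apply: walk_image => [x|x y [s sS ->]]; first by rewrite lerBlDl chiM.
by exists s => //; rewrite mulgA.
Qed.

Lemma walk_gen S c u s : S s -> (c <= chi u)%R -> (c <= chi (u * s))%R ->
  walk chi S c u (u * s).
Proof. by move=> Ss cu cus; apply: rt_step; split=> //; exists s => //; left. Qed.

Lemma walkX S c u t n : S t -> (0 <= chi t)%R -> (c <= chi u)%R ->
  walk chi S c u (u * t ^+ n).
Proof.
move=> St t0 cu.
have cX m : (c <= chi (u * t ^+ m))%R.
  by rewrite chiM charX// (le_trans cu)// lerDl mulrn_wge0.
elim: n => [|n IHn]; first by rewrite expg0 mulg1; apply: rt_refl.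
apply: rt_trans IHn _; rewrite expgSr mulgA; apply: walk_gen => //.
by rewrite -mulgA -expgSr.
Qed.

(** Translating by a high power of an element of positive character carries the
connectedness of the part above level 0 to every level, at the price of moving
the endpoints up. *)
Lemma connected_above S : chi <> zero_char ->
    cayley_connected S (nonneg_part chi) ->
  forall c, exists d, forall u v, (d <= chi u)%R -> (d <= chi v)%R ->
    walk chi S c u v.
Proof.
move=> /(char_pos chiM)[t t0] Sconn c.
have [N /(_ N (leqnn N)) cN] := char_large chiM t0 c.
exists (chi (t ^+ N)) => u v du dv.
rewrite -(mulVKg (t ^+ N) u) -(mulVKg (t ^+ N) v); apply: walkM.
apply: (@walkS S S 0%R) => //; first by rewrite subr_le0.
by apply: Sconn; rewrite /nonneg_part/= chiM charV// addrC subr_ge0.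
Qed.

Lemma Sigma1_intro S : finite_set S -> generated_subgroup S = setT ->
    chi <> zero_char -> (forall v, (0 <= chi v)%R -> walk chi S 0 1 v) ->
  Sigma1 R V (char_class chi).
Proof.
move=> Sfin Sgen chi0 Swalk; apply/(Sigma1P chiM (conj Sfin Sgen)); split=> //.
move=> u v u0 v0; apply: rt_trans (Swalk v v0).
exact/walk_sym/Swalk.
Qed.

Lemma Sigma1_elim : Sigma1 R V (char_class chi) ->
  chi <> zero_char /\
  exists2 S, fin_gen_set S & cayley_connected S (nonneg_part chi).
Proof.
move=> Schi; have [_ [_ _ [S Sfg _]]] := Schi.
by have [chi0 Sconn] := (Sigma1P chiM Sfg).1 Schi; split=> //; exists S.
Qed.

End OneGroup.
End Walks.

Section Quotients.
Local Open Scope classical_set_scope.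
Local Open Scope group_scope.
Context (R : realType) (V Q : groupType) (pi : V -> Q) (iota : Q -> V).

(** A walk upstairs projects to a walk at the same level, because the level of
a vertex is read off from its image. *)
Lemma Sigma1_quotient (psi : Q -> R) :
    {morph pi : u v / u * v} -> cancel iota pi -> is_character psi ->
    is_character (psi \o pi) ->
  Sigma1 R V (char_class (psi \o pi)) -> Sigma1 R Q (char_class psi).
Proof.
move=> piM iotaK psiM chiM /(Sigma1_elim chiM)[chi0 [S [Sfin Sgen] Sconn]].
have pi1 : pi 1 = 1 by apply: (@mulgI _ (pi 1)); rewrite -piM !mulg1.
have piV u : pi u^-1 = (pi u)^-1.
  by apply: (@mulgI _ (pi u)); rewrite -piM !mulgV.
apply: (Sigma1_intro psiM (S := pi @` S)) => [||psi0|q q0].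
- exact: finite_image.
- apply: generated_setT => P P1 PV PS q; rewrite -(iotaK q).
  move: (iota q); apply: (generated_ind Sgen) => [|u v|s Ss].
  + by rewrite pi1.
  + by rewrite piM piV; apply: PV.
  + by apply: PS; exists s.
- by apply: chi0; rewrite psi0.
- rewrite -(iotaK q) -pi1.
  apply: (walk_image (chi := psi \o pi) (S := S) (c := 0%R)) => // [u v|].
    case=> s sS ->; exists (pi s) => //.
    by case: sS => sS; [left; exists s|right; exists s^-1; rewrite ?piV].
  by apply: Sconn; rewrite /nonneg_part/= ?iotaK// pi1 char1.
Qed.

End Quotients.

(** * Liftable elements *)

Section Liftable.
Local Open Scope classical_set_scope.
Local Open Scope group_scope.
Context (R : realType) (V : groupType) (chi : V -> R).
Hypothesis chiM : is_character chi.
Context (t : V).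
Hypothesis t_gt0 : (0 < chi t)%R.
Implicit Types (F : set V) (s u v p q : V) (c : R).

(** The set of steps F is part of the notion: with all of V as steps, every
element would be liftable. *)
Definition liftable F s := forall c, exists N, forall n, (N <= n)%N ->
  walk chi F c (t ^+ n) (s * t ^+ n).

Lemma liftable_sub F F' s : F `<=` F' -> liftable F s -> liftable F' s.
Proof.
move=> FF' Fs c; have [N NP] := Fs c; exists N => n /NP.
exact: walkS.
Qed.

Lemma liftable1 F : liftable F 1.
Proof. by move=> c; exists 0%N => n _; rewrite mul1g; apply: rt_refl. Qed.

(** Translating a walk shifts its level by a constant, and liftability provides
walks above every level. *)
Lemma liftable_div F u v : liftable F u -> liftable F v -> liftable F (u * v^-1).
Proof.
move=> Fu Fv c; have [N NP] := Fu c.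
have [M MP] := Fv (c - chi (u * v^-1))%R.
exists (maxn N M) => n; rewrite geq_max => /andP[/NP nu /MP nv].
apply: rt_trans nu _; have /walk_sym := walkM chiM nv.
by rewrite mulgA mulgVK.
Qed.

(** To join 1 to v above level 0, climb along powers of t, cross to v t^n while
staying high, and climb down.  The crossing exists for every v once it does for
generators, because liftable elements form a subgroup. *)
Lemma Sigma1_liftable (B : set V) :
    fin_gen V -> generated_subgroup B = setT ->
    (forall b, B b -> exists2 F, finite_set F & liftable F b) ->
  Sigma1 R V (char_class chi).
Proof.
move=> [S [Sfin Sgen]] Bgen Blift.
have lift v : exists2 F, finite_set F & liftable F v.
  move: v; apply: (generated_ind Bgen) => // [|u v [E Efin Eu] [F Ffin Fv]].
    by exists set0 => //; apply: liftable1.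
  exists (E `|` F); first by rewrite finite_setU.
  by apply: liftable_div; [apply: liftable_sub Eu|apply: liftable_sub Fv];
    move=> x; [left|right].
have /choice[F FP] : forall v, exists F, finite_set F /\ liftable F v.
  by move=> v; have [F] := lift v; exists F.
(* A single finite set of steps lifts the finitely many generators in S, hence
   every element of V. *)
pose T := [set t] `|` (S `|` \bigcup_(s in S) F s).
have Tlift v : liftable T v.
  move: v; apply: (generated_ind Sgen) => [|u v|s Ss].
  - exact: liftable1.
  - exact: liftable_div.
  - have [_] := FP s; apply: liftable_sub => x Fx.
    by right; right; exists s.
apply: (Sigma1_intro chiM (S := T)) => [|||v v0].
- rewrite !finite_setU; split=> //; split=> //.
  by apply: bigcup_finite => // s _; have [] := FP s.
- apply: generated_setT => P P1 PV PT; apply: (generated_ind Sgen) => // s Ss.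
  by apply: PT; right; left.
- by move=> chi0; move: t_gt0; rewrite chi0 ltxx.
have Tt : T t by left.
have [n /(_ n (leqnn n)) tv] := Tlift v 0%R.
apply: (@rt_trans _ _ _ (t ^+ n)).
  by rewrite -[t ^+ n]mul1g; apply: walkX; rewrite // ?char1// ltW.
apply: rt_trans tv _; apply: walk_sym; apply: walkX => //; exact: ltW.
Qed.

(** The crossing slides along the commutation relations:
  t^n ~ t^n p^n = p^n t^n ~ p^n ~ p^n s = s q^n ~ s q^n t^n = s t^n q^n ~ s t^n.
Here chi q = chi p > 0, so all levels on the way tend to infinity with n. *)
Lemma liftable_commuting s p q :
    commute t p -> commute t q -> p * s = s * q -> (0 < chi p)%R ->
  exists2 F, finite_set F & liftable F s.
Proof.
move=> tp tq psq p0; exists ([set s] `|` ([set t] `|` ([set p] `|` [set q]))).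
  by rewrite !finite_setU.
set F := (F in liftable F).
have [Fs Ft Fp Fq] : [/\ F s, F t, F p & F q].
  by split; rewrite /F/=; tauto.
have q0 : (0 < chi q)%R.
  by have := congr1 chi psq; rewrite !chiM addrC => /addrI <-.
have psX n : p ^+ n * s = s * q ^+ n.
  elim: n => [|n IHn]; first by rewrite !expg0 mul1g mulg1.
  by rewrite expgS -mulgA IHn mulgA psq -mulgA -expgS.
move=> c.
have [N NP] := char_large chiM t_gt0 (Num.max c (c - chi s))%R.
have [M MP] := char_large chiM p0 (Num.max c (c - chi s))%R.
exists (maxn N M) => n; rewrite geq_max => /andP[/NP + /MP].
rewrite !ge_max !lerBlDr => /andP[ct cts] /andP[cp cps].
have t0 := ltW t_gt0; have {}p0 := ltW p0; have {}q0 := ltW q0.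
apply: (@rt_trans _ _ _ (p ^+ n * t ^+ n)).
  by rewrite -(commuteX2 n n tp); apply: walkX.
apply: (@rt_trans _ _ _ (p ^+ n)); first exact/walk_sym/walkX.
apply: (@rt_trans _ _ _ (p ^+ n * s)); first by apply: walk_gen; rewrite ?chiM.
apply: (@rt_trans _ _ _ (p ^+ n * s * t ^+ n)); first by apply: walkX; rewrite ?chiM.
rewrite psX -mulgA -(commuteX2 n n tq) mulgA; apply/walk_sym/walkX => //.
by rewrite chiM addrC.
Qed.

Section Subgroup.
Context (U : groupType) (iota : U -> V) (t0 : U).
Implicit Types x y : U.
Hypotheses (iotaM : {morph iota : u v / u * v}) (iota_t0 : iota t0 = t).

Let psiM : is_character (chi \o iota).
Proof. by move=> u v /=; rewrite iotaM chiM. Qed.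

Let iotaX x n : iota (x ^+ n) = iota x ^+ n.
Proof.
elim: n => [|n IHn]; last by rewrite !expgS iotaM IHn.
by rewrite !expg0; apply: (@mulgI _ (iota 1)); rewrite -iotaM !mulg1.
Qed.

Let iotaV x : iota x^-1 = (iota x)^-1.
Proof.
by apply: (@mulgI _ (iota x)); rewrite -iotaM !mulgV; apply: (iotaX 1 0).
Qed.

Lemma subgroup_walk : Sigma1 R U (char_class (chi \o iota)) ->
  exists2 F, finite_set F & forall c, exists d, forall x y : U,
    (d <= chi (iota x))%R -> (d <= chi (iota y))%R ->
    walk chi F c (iota x) (iota y).
Proof.
move=> /(Sigma1_elim psiM)[psi0 [S [Sfin _] Sconn]].
exists (iota @` S); first exact: finite_image.
move=> c; have [d dP] := connected_above psiM psi0 Sconn c.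
exists d => u v du dv; apply: walk_image (dP u v du dv) => // x y [s sS ->].
exists (iota s) => //.
by case: sS => sS; [left; exists s|right; exists s^-1; rewrite ?iotaV].
Qed.

Lemma liftable_subgroup x : Sigma1 R U (char_class (chi \o iota)) ->
  exists2 F, finite_set F & liftable F (iota x).
Proof.
move=> /subgroup_walk[F Ffin FP]; exists F => // c.
have [d dP] := FP c.
have [N NP] := char_large chiM t_gt0 (Num.max d (d - chi (iota x)))%R.
exists N => n /NP; rewrite ge_max lerBlDl => /andP[dt dts].
by rewrite -iota_t0 -iotaX -iotaM; apply: dP; rewrite ?iotaM ?iotaX ?iota_t0 ?chiM.
Qed.

(** With p read in V, the route is t^n ~ p^M inside U, then the single edge
p^M ~ p^M s = s p^M, then s p^M ~ s t^n, the translate by s of a walk in U. *)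
Lemma liftable_centralizing s (p : U) :
    Sigma1 R U (char_class (chi \o iota)) -> commute (iota p) s ->
    (0 < chi (iota p))%R ->
  exists2 F, finite_set F & liftable F s.
Proof.
move=> /subgroup_walk[F Ffin FP] ps p0; exists ([set s] `|` F).
  by rewrite finite_setU.
move=> c; have [d dP] := FP c; have [e eP] := FP (c - chi s)%R.
have [N NP] := char_large chiM t_gt0 (Num.max d e).
have [M /(_ M (leqnn M))] := char_large chiM p0
  (Num.max (Num.max d e) (Num.max c (c - chi s)))%R.
rewrite !ge_max => /andP[/andP[dp ep] /andP[cp]]; rewrite lerBlDr => cps.
exists N => n /NP; rewrite ge_max => /andP[dt et].
have FF : F `<=` [set s] `|` F by move=> x; right.
rewrite -iota_t0 -iotaX in dt et *; rewrite -iotaX in dp ep cp cps.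
apply: (@rt_trans _ _ _ (iota (p ^+ M))); first exact: walkS (dP _ _ _ _).
apply: (@rt_trans _ _ _ (s * iota (p ^+ M))).
  have -> : s * iota (p ^+ M) = iota (p ^+ M) * s.
    by rewrite iotaX; apply/esym/commute_sym/commuteX/commute_sym.
  by apply: walk_gen; rewrite ?chiM//; left.
by apply: walkM => //; apply: walkS (eP _ _ _ _).
Qed.

End Subgroup.
End Liftable.

(** * Generators and characters of wreath products *)

Section Wreath.
Local Open Scope classical_set_scope.
Local Open Scope group_scope.
Context (H G : groupType) (X : choiceType) (a : gset_action G X).
Local Notation W := (wreath H a).
Local Notation top := (@in_top H X G a).
Local Notation copy := (@in_copy H X G a).
Local Notation base := (@in_base H X G a).
Implicit Types (g k : G) (h l : H) (x y z : X) (m n : dirsum H X) (u v : W).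

Lemma in_topM : {morph top : g k / g * k}.
Proof. by move=> g k; congr SDProd; apply: dirsumP => x /=; rewrite mulg1. Qed.

Lemma in_topV g : top g^-1 = (top g)^-1.
Proof.
apply: (@mulgI _ (top g)); rewrite -in_topM !mulgV.
by congr SDProd; apply: dirsumP.
Qed.

Lemma in_baseM : {morph base : m n / m * n}.
Proof.
move=> m n; congr SDProd; last by rewrite /= mulg1.
by apply: dirsumP => x /=; rewrite invg1 gact1.
Qed.

Lemma in_copyM x : {morph copy x : h l / h * l}.
Proof.
move=> h l; rewrite /in_copy -in_baseM; congr base; apply: dirsumP => y /=.
by case: eqP; rewrite ?mulg1.
Qed.

Lemma in_copyV x h : copy x h^-1 = (copy x h)^-1.
Proof.
apply: (@mulgI _ (copy x h)); rewrite -in_copyM !mulgV.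
by congr SDProd; apply: dirsumP => y /=; case: eqP.
Qed.

Lemma in_topJ g x h : top g * copy x h = copy (a g x) h * top g.
Proof. by rewrite -in_copyJ mulgVK. Qed.

Lemma in_copyC x y h l : x <> y -> commute (copy x h) (copy y l).
Proof.
move=> xy; rewrite /commute /in_copy -!in_baseM; congr base.
apply: dirsumP => z /=.
by case: eqP => [->|_]; case: eqP => // _; rewrite ?mulg1 ?mul1g.
Qed.

Lemma in_topC g x h : a g x = x -> commute (top g) (copy x h).
Proof. by move=> gx; rewrite /commute in_topJ gx. Qed.

Lemma wreathE v : v = base (sdbase v) * top (sdtop v).
Proof.
case: v => m g; congr SDProd; last by rewrite /= mul1g.
by apply: dirsumP => x /=; rewrite mulg1.
Qed.

Definition standard_gens : set W :=
  [set v | (exists g, v = top g) \/ (exists x h, v = copy x h)].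

(** Induction on a finite list containing the support, peeling off one
coordinate at a time. *)
Lemma dirsum_ind (P : dirsum H X -> Prop) :
    P 1 -> (forall m n, P m -> P n -> P (m * n)) ->
    (forall x h, P (ds_single x h)) ->
  forall m, P m.
Proof.
move=> P1 PM Psingle m; have /finite_seqP[s ms] := dsfin m.
have {ms}: [set x | m x <> 1] `<=` [set` s] by rewrite ms.
elim: s m => [|x s IHs] m ms.
  suff -> : m = 1 by [].
  by apply: dirsumP => x; apply: contrapT => /ms.
rewrite -(mulVKg (ds_single x (m x)) m); apply: (PM _ _ (Psingle _ _)).
apply: IHs => y /=; case: (eqVneq y x) => [->|yx]; first by rewrite mulVg.
by rewrite invg1 mul1g => /ms/=; rewrite inE (negbTE yx).
Qed.

Lemma standard_gens_gen : generated_subgroup standard_gens = setT.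
Proof.
apply: generated_setT => P P1 PV PB v.
have PM u w : P u -> P w -> P (u * w).
  move=> Pu Pw; rewrite -(invgK w); apply: (PV _ _ Pu).
  by rewrite -[w^-1]mul1g; apply: PV.
rewrite (wreathE v); apply: (PM); last by apply: PB; left; exists (sdtop v).
move: (sdbase v); apply: dirsum_ind => [//|m n Pm Pn|x h].
  by rewrite in_baseM; apply: PM.
by apply: PB; right; exists x, h.
Qed.

Section Characters.
Context (R : realType).

Lemma wreath_char_eq (chi psi : W -> R) :
    is_character chi -> is_character psi ->
    (forall g, chi (top g) = psi (top g)) ->
    (forall x h, chi (copy x h) = psi (copy x h)) ->
  chi = psi.
Proof.
move=> chiM psiM topE copyE; apply/funext.
apply: (generated_ind standard_gens_gen) => [|u v uE vE|v].
- by rewrite !char1.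
- by rewrite chiM psiM !charV// uE vE.
- by case=> [[g ->]|[x [h ->]]].
Qed.

Context (chi : W -> R).
Hypothesis chiM : is_character chi.

Lemma char_topM : is_character (chi \o top).
Proof. by move=> g k; rewrite /= in_topM chiM. Qed.

Lemma char_copyM x : is_character (chi \o copy x).
Proof. by move=> h l; rewrite /= in_copyM chiM. Qed.

Lemma char_copy_act g x h : chi (copy (a g x) h) = chi (copy x h).
Proof. by rewrite -in_copyJ !chiM charV// addrAC subrr add0r. Qed.

Lemma char_copy0 x : chi \o copy x = zero_char -> forall h, chi (copy x h) = 0%R.
Proof. by move=> chi0 h; apply: (congr1 (fun f => f h) chi0). Qed.

Lemma char_base0 : chi \o base = zero_char <-> forall x, chi \o copy x = zero_char.
Proof.
split=> [chi0 x|chi0].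
  by apply/funext => h; apply: (congr1 (fun f => f (ds_single x h)) chi0).
apply/funext; apply: dirsum_ind => [|m n /= m0 n0|x h].
- exact: (char1 chiM).
- by rewrite in_baseM chiM m0 n0 addr0.
- exact: char_copy0.
Qed.

End Characters.

End Wreath.

(** * The first invariant of wreath products *)

Section Sigma1Wreath.
Local Open Scope classical_set_scope.
Local Open Scope group_scope.
Context (R : realType) (H G : groupType) (X : choiceType) (a : gset_action G X).
Local Notation W := (wreath H a).
Local Notation top := (@in_top H X G a).
Local Notation copy := (@in_copy H X G a).
Local Notation base := (@in_base H X G a).
Context (chi : W -> R).
Hypothesis chiM : is_character chi.

Section TrivialOnBase.
Hypothesis base0 : chi \o base = zero_char.

Let copy0 x h : chi (copy x h) = 0%R.
Proof. exact/char_copy0/(char_base0 chiM).1. Qed.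

Let topE v : chi v = chi (top (sdtop v)).
Proof.
rewrite {1}(wreathE v) chiM -[LHS]/((chi \o base) (sdbase v) + _)%R base0.
by rewrite /zero_char/= add0r.
Qed.

Lemma Sigma1_top : Sigma1 R W (char_class chi) ->
  Sigma1 R G (char_class (chi \o top)).
Proof.
have chiE : chi = (chi \o top) \o @sdtop _ _ _ by apply/funext.
rewrite {1}chiE.
apply: (Sigma1_quotient (iota := top)) => //; first exact: char_topM.
by rewrite -chiE.
Qed.

(** Sigma^1 is tested on a possibly infinite generating set that avoids the copies at
the other points of the orbit of x: connectedness for one finite generating set
gives it for every generating set. *)
Lemma Sigma1_stabilizer x : (exists h : H, h <> 1) ->
    Sigma1 R W (char_class chi) ->
  exists2 g, stabilizer a x g & chi (top g) <> 0%R.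
Proof.
move=> [h h1] /(Sigma1_elim chiM)[chi0 [S [Sfin _] Sconn]].
apply: contrapT => stab0.
have {}stab0 g : a g x = x -> chi (top g) = 0%R.
  by move=> gx; apply: contrapT => g0; apply: stab0; exists g.
pose T : set W := [set v | (exists g, v = top g) \/
  exists z k, v = copy z k /\ forall g, z = a g x -> z = x].
have TV v : T v^-1 -> T v.
  rewrite -{2}(invgK v); case=> [[g ->]|[z [k [-> zx]]]].
    by left; exists g^-1; rewrite in_topV.
  by right; exists z, k^-1; rewrite in_copyV.
have Tgen : generated_subgroup T = setT.
  apply: generated_setT => P P1 PV PT.
  apply: (generated_ind (@standard_gens_gen H G X a)) => // v [[g ->]|[z [k ->]]].
    by apply: PT; left; exists g.
  have [[g zE]|zx] := pselect (exists g, z = a g x); last first.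
    by apply: PT; right; exists z, k; split=> // g zE; case: zx; exists g.
  have Px : P (copy x k) by apply: PT; right; exists x, k.
  have Ptop g' : P (top g') by apply: PT; left; exists g'.
  rewrite zE -in_copyJ; apply: (PV _ _ _ (Ptop g)).
  rewrite -[copy x k]invgK; apply: (PV _ _ (Ptop g)).
  by rewrite -[_^-1]mul1g; apply: PV.
(* The invariant of walks above level 0: coordinates of negative height in the
   orbit of x are trivial. *)
pose flat (v : W) := forall g, (chi (top g) < 0)%R -> sdbase v (a g x) = 1.
have walk_flat u v : walk chi T 0 u v -> flat u -> flat v.
  elim=> {u v} [u v [u0 _ [s sT ->]]|//|u v w _ IH1 _ IH2 /IH1/IH2//] uflat g g0.
  have {sT}: T s by case: sT => // /TV.
  case=> [[k ->]|[z [k [-> zx]]]]; first by rewrite /= mulg1 uflat.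
  rewrite /= uflat// mul1g; case: eqP => // zE.
  (* The step changes the coordinate at g x only if u^-1 g fixes x; then g and u
     have the same height, contradicting chi g < 0 <= chi u. *)
  move: (zE); rewrite (zx ((sdtop u)^-1 * g)) -?zE ?gactM// => ugx.
  have := stab0 ((sdtop u)^-1 * g); rewrite gactM => /(_ ugx).
  rewrite in_topM chiM in_topV charV// -topE => /eqP.
  by rewrite addrC subr_eq0 => /eqP gu; move: g0; rewrite gu ltNge u0.
have [v] := char_pos chiM chi0; rewrite topE -oppr_lt0 -charV// -in_topV => v0.
have copy_flat : flat (copy (a (sdtop v)^-1 x) h).
  apply: (@walk_flat 1) => //.
  by apply: (cayley_connected_indep chiM chi0 Sfin Tgen Sconn);
    rewrite /nonneg_part/= ?char1// copy0.
by apply: h1; rewrite -(copy_flat _ v0) /= eqxx.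
Qed.

Lemma Sigma1_trivial_base : fin_gen W ->
    Sigma1 R G (char_class (chi \o top)) ->
    (forall x, exists2 g, stabilizer a x g & chi (top g) <> 0%R) ->
  Sigma1 R W (char_class chi).
Proof.
move=> Wfg SG stab.
have [top0 _] := Sigma1_elim (char_topM chiM) SG.
have [t t0] := char_pos (char_topM chiM) top0.
apply: (Sigma1_liftable chiM t0 Wfg (@standard_gens_gen H G X a)) => v.
case=> [[g ->]|[x [h ->]]].
  exact: (liftable_subgroup chiM t0 (@in_topM _ _ _ a) erefl).
suff [g gx g0] : exists2 g, stabilizer a x g & (0 < chi (top g))%R.
  apply: (liftable_centralizing chiM t0 (@in_topM _ _ _ a) erefl SG _ g0).
  exact: in_topC.
have [g gx /(charV_gt0 chiM)[g0|]] := stab x; first by exists g.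
rewrite -in_topV => g0; exists g^-1 => //.
by rewrite /stabilizer/= -{1}gx -gactM mulVg gact1.
Qed.

End TrivialOnBase.

Section NontrivialOnBase.
Hypothesis Wfg : fin_gen W.

Lemma Sigma1_two_copies x y : x <> y ->
    chi \o copy x <> zero_char -> chi \o copy y <> zero_char ->
  Sigma1 R W (char_class chi).
Proof.
move=> xy /(char_pos (char_copyM chiM x))[h h0].
move=> /(char_pos (char_copyM chiM y))[k k0].
apply: (Sigma1_liftable chiM h0 Wfg (@standard_gens_gen H G X a)) => v.
case=> [[g ->]|[z [l ->]]].
  apply: (liftable_commuting chiM h0 (p := copy (a g x) h) (q := copy x h)) => //.
  - have [->//|gx] := pselect (a g x = x).
    by apply: in_copyC => /esym.
  - by rewrite in_topJ.
  - by rewrite char_copy_act.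
have [->|zx] := pselect (z = x).
  have yC h' : commute (copy x h') (copy y k) by apply: in_copyC.
  exact: (liftable_commuting chiM h0 (yC h) (yC h) (esym (yC l)) k0).
apply: (liftable_commuting chiM h0 (p := copy x h) (q := copy x h)) => //.
by apply: in_copyC => /esym.
Qed.

Section OneCopy.
Context (x : X).
Hypothesis copyx : chi \o copy x <> zero_char.
Hypothesis copyy : forall y, y <> x -> chi \o copy y = zero_char.

(** chi takes the same values on H_x and H_(g x), so G permutes the copies on
which chi is non-zero. *)
Lemma act_only_copy g : a g x = x.
Proof.
apply: contrapT => /copyy gx; apply: copyx; apply/funext => h.
by rewrite /= -(char_copy_act chiM g) char_copy0.
Qed.

Lemma Sigma1_top_neq0 : chi \o top <> zero_char -> Sigma1 R W (char_class chi).
Proof.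
move=> /(char_pos (char_topM chiM))[g g0].
have [h h0] := char_pos (char_copyM chiM x) copyx.
have gh l : commute (top g) (copy x l) by apply/in_topC/act_only_copy.
apply: (Sigma1_liftable chiM h0 Wfg (@standard_gens_gen H G X a)) => v.
case=> [[k ->]|[z [l ->]]].
  apply: (liftable_commuting chiM h0 (p := copy x h) (q := copy x h)) => //.
  exact/commute_sym/in_topC/act_only_copy.
have [->|zx] := pselect (z = x).
  exact: (liftable_commuting chiM h0 (esym (gh h)) (esym (gh h)) (gh l) g0).
apply: (liftable_commuting chiM h0 (p := copy x h) (q := copy x h)) => //.
by apply: in_copyC => /esym.
Qed.

Lemma Sigma1_of_copy : Sigma1 R H (char_class (chi \o copy x)) ->
  Sigma1 R W (char_class chi).
Proof.
move=> SH; have [h h0] := char_pos (char_copyM chiM x) copyx.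
apply: (Sigma1_liftable chiM h0 Wfg (@standard_gens_gen H G X a)) => v.
have central s : commute (copy x h) s ->
    exists2 F, finite_set F & liftable chi (copy x h) F s.
  move=> hs.
  exact: (liftable_centralizing chiM h0 (@in_copyM _ _ _ a x) erefl SH hs h0).
case=> [[k ->]|[z [l ->]]].
  exact/central/commute_sym/in_topC/act_only_copy.
have [->|zx] := pselect (z = x).
  exact: (liftable_subgroup chiM h0 (@in_copyM _ _ _ a x) erefl).
by apply/central/in_copyC => /esym.
Qed.

Lemma Sigma1_to_copy : chi \o top = zero_char ->
  Sigma1 R W (char_class chi) -> Sigma1 R H (char_class (chi \o copy x)).
Proof.
move=> top0; pose pi (v : W) := sdbase v x.
have piM : {morph pi : u v / u * v}.
  by move=> u v; rewrite /pi/= act_only_copy.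
have psiM : is_character ((chi \o copy x) \o pi).
  by move=> u v; rewrite /= piM in_copyM chiM.
have chiE : chi = (chi \o copy x) \o pi.
  apply: (wreath_char_eq chiM psiM) => [g|y h].
    rewrite -[LHS]/((chi \o top) g) top0 /=.
    exact/esym/(char1 (char_copyM chiM x)).
  rewrite /pi/=; case: eqP => [->//|/nesym yx].
  by rewrite char_copy0 ?copyy//; apply/esym/(char1 (char_copyM chiM x)).
rewrite {1}chiE; apply: (Sigma1_quotient (iota := copy x)) => //.
- by move=> h; rewrite /pi/= eqxx.
- exact: char_copyM.
Qed.

End OneCopy.
End NontrivialOnBase.
End Sigma1Wreath.

Theorem theorem1 (R : realType) (H G : groupType) (X : choiceType)
    (a : gset_action G X)
    (H_nontrivial : exists h : H, h <> 1%g)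
    (X_nonempty : inhabited X)
    (Gamma_fin_gen : fin_gen (wreath H a))
    (chi : wreath H a -> R)
    (chi_char : is_character chi)
    (chi_nontrivial : chi <> zero_char) :
  (chi \o in_base a = zero_char ->
     (Sigma1 R (wreath H a) (char_class chi) <->
      Sigma1 R G (char_class (chi \o in_top a)) /\
      forall x : X,
        exists2 g : G, stabilizer a x g & chi (in_top a g) <> 0%R)) /\
  (chi \o in_base a <> zero_char ->
     (Sigma1 R (wreath H a) (char_class chi) <->
      [\/ exists x y : X, [/\ x <> y, chi \o in_copy a x <> zero_char
                            & chi \o in_copy a y <> zero_char],
          exists x : X, chi \o in_copy a x <> zero_char /\
                        Sigma1 R H (char_class (chi \o in_copy a x))
        | chi \o in_top a <> zero_char])).
Proof.
split=> [base0|base_neq0].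
  split=> [SW|[SG stab]]; last exact: Sigma1_trivial_base.
  by split=> [|x]; [apply: Sigma1_top|apply: Sigma1_stabilizer].
have [x copyx] : exists x, chi \o in_copy a x <> zero_char.
  apply: contrapT => copy0; apply: base_neq0; apply/(char_base0 chi_char) => x.
  by apply: contrapT => copyx; apply: copy0; exists x.
have [[y [yx copyy]]|copyy] :=
    pselect (exists y, y <> x /\ chi \o in_copy a y <> zero_char).
  split=> [_|_]; first by apply: Or31; exists y, x.
  exact: Sigma1_two_copies yx copyy copyx.
have {}copyy y : y <> x -> chi \o in_copy a y = zero_char.
  by move=> yx; apply: contrapT => ?; apply: copyy; exists y.
split=> [SW|].
  have [top0|] := pselect (chi \o in_top a = zero_char); last exact: Or33.
  by apply: Or32; exists x; split=> //; apply: Sigma1_to_copy.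
have only y : chi \o in_copy a y <> zero_char -> y = x.
  by move=> cy; apply: contrapT => /copyy.
case=> [[y [z [yz /only yx /only zx]]]|[y [/only -> SH]]|].
- by case: yz; rewrite yx zx.
- exact: (Sigma1_of_copy chi_char Gamma_fin_gen copyx copyy SH).
- exact: (Sigma1_top_neq0 chi_char Gamma_fin_gen copyx copyy).
Qed.
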